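(* Let $0<\lambda\leqslant1/6$ be real and let $r\geqslant 2$, $\ell\geqslant1$, $m\geqslant1$ be integers. If $p$ is a real number with $p^{\geqslant}_\lambda(r,\ell,m)\geqslant p>0$, then $$m\leqslant 1+2\sqrt{\frac{\ln(1/p)\,(2r-1)^{1+\lceil\lambda\ell\rceil}}{2\ell(r-1)}}.$$ In particular, this bound holds if $p^{\geqslant}_\lambda(r,\ell,m)\geqslant p_\lambda(r,\ell,\ell,m)\geqslant p>0$.
   Context: Let $\mathrm{FR}(r,k)=2r(2r-1)^{k-1}$ (for $k\geqslant1$, the number of freely reduced words of length $k$ in the free group of rank $r$; the formula is also used for $k=0$) and $\mathrm{CR}(r,k)=(2r-1)^k+1+(r-1)(1+(-1)^k)$ (for $k\geqslant1$, the number of cyclically reduced words of length $k$). The function $p^{\geqslant}_\lambda(r,\ell,m)$ is defined as follows. If $\mathrm{FR}(r,\lceil\lambda\ell\rceil)<2m\ell$, then $p^{\geqslant}_\lambda(r,\ell,m)=0$. Otherwise write $\ell=\ell_1\lceil\lambda\ell\rceil+\ell_2$ with $\ell_1,\ell_2\in\mathbb{N}$, $0\leqslant\ell_2<\lceil\lambda\ell\rceil$, and $$p^{\geqslant}_\lambda(r,\ell,m)=\frac{1}{\mathrm{CR}(r,\ell)^m}\prod_{i=1}^{m}\min\Bigl[\omega_i,\ \mathrm{FR}(r,\ell_2)\prod_{k=1}^{\ell_1}\min\bigl((2r-1)^{\lceil\lambda\ell\rceil},\alpha_{i,k}\bigr)\Bigr],$$ where $\omega_i=\mathrm{CR}(r,\ell)-4(i-1)\ell(r-1)(2r-1)^{\ell-\lceil\lambda\ell\rceil-1}$,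 $\alpha_{i,1}=\mathrm{FR}(r,\lceil\lambda\ell\rceil)-2(i-1)\ell$, and $\alpha_{i,k}=\mathrm{FR}(r,\lceil\lambda\ell\rceil)-2(i-1)\ell-2\bigl((k-2)\lceil\lambda\ell\rceil+\ell_2+1\bigr)$ for $k\geqslant2$. $p_\lambda(r,\ell,\ell,m)$ denotes the probability that a presentation $\langle X\mid W\rangle$, chosen uniformly at random among all those with $|X|=r$, $|W|=m$ and $|w|=\ell$ for each $w\in W$, has property $C'(\lambda)$. Here $X$ is a fixed set with $r$ elements, and elements of the free group $F(X)$ are identified with freely reduced words over $X^{\pm1}$; $|w|$ is word length. A word is cyclically reduced if all its cyclic permutations are freely reduced. For $0\leqslant d<|w|$, $w_{\ll d}$ is the left cyclic permutation of $w$ by distance $d$. A presentation with $m$ relators is given by an ordered list $W\in F(X)^m$ of cyclically reduced words, repetitions allowed, lists differing by a permutation being distinct; the uniform distribution is on such lists. The symmetric closure is $W^S=\{w_{\ll d},(w_{\ll d})^{-1}: w\in W,\ 0\leqslant d<|w|\}$. $W$ is minimal if there is no proper sublist $U$ with $U^S=W^S$. A cyclically reduced word $w$ is power-free if $|(w)^S|=2|w|$. $\langle X\mid W\rangle$ has property $C'(\lambda)$ if $W$ is minimal, each $w\in W$ is power-free, and for any two distinct words $u,w\in W^S$: if $u=pa$ and $w=pb$ with $p,a,b\in F(X)$, $|u|=|p|+|a|$, $|w|=|p|+|b|$, then $|p|<\lambda\cdot\min(|u|,|w|)$. *)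

(* Defs.v *)
From mathcomp Require Import all_boot all_order all_algebra.
From mathcomp Require Import all_classical all_reals all_analysis.
Set Implicit Arguments.
Unset Strict Implicit.
Unset Printing Implicit Defensive.
Import Order.TTheory GRing.Theory Num.Theory.

Section Words.
Variable X : finType.

(* (x, true) is the generator x and (x, false) its inverse. *)
Definition letter : finType := (X * bool)%type.
Definition word := seq letter.

Definition letter_inv (x : letter) : letter := (x.1, ~~ x.2).

Definition freely_reduced (w : word) : bool :=
  sorted (fun x y => y != letter_inv x) w.

Definition free_cons (x : letter) (w : word) : word :=
  if w is y :: w' then if y == letter_inv x then w' else x :: w else [:: x].

Definition free_reduction (w : word) : word := foldr free_cons [::] w.

(* The free group F(X) is the set of freely reduced words; its product is
   concatenation followed by free reduction. *)
Definition free_mul (u v : word) : word := free_reduction (u ++ v).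

Definition free_inv (w : word) : word := rev (map letter_inv w).

(* [rot d w] is the left cyclic permutation of [w] by distance [d]. *)
Definition cyclically_reduced (w : word) : bool :=
  freely_reduced w && all (fun d => freely_reduced (rot d w)) (iota 0 (size w)).

(* The symmetric closure, as a list to be read up to [=i]. *)
Definition sym_closure (W : seq word) : seq word :=
  flatten [seq [:: rot d w; free_inv (rot d w)] | w <- W, d <- iota 0 (size w)].

Definition minimal (W : seq word) : Prop :=
  forall U : seq word, subseq U W -> U != W ->
    ~ (sym_closure U =i sym_closure W).

Definition power_free (w : word) : bool :=
  size (undup (sym_closure [:: w])) == (2 * size w)%N.

Local Open Scope ring_scope.

Definition Cprime (R : realType) (lambda : R) (W : seq word) : Prop :=
  [/\ minimal W,
      forall w, w \in W -> power_free w
    & forall u w : word, u \in sym_closure W -> w \in sym_closure W -> u != w ->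
      forall p a b : word,
        freely_reduced p -> freely_reduced a -> freely_reduced b ->
        u = free_mul p a -> w = free_mul p b ->
        size u = (size p + size a)%N -> size w = (size p + size b)%N ->
        (size p)%:R < lambda * (minn (size u) (size w))%:R].

End Words.

Section Counting.
Local Open Scope ring_scope.
Variable R : realType.

(* The exponent [k - 1] is an integer: [FR r 0] is [2r / (2r - 1)]. *)
Definition FR (r k : nat) : R :=
  (2 * r)%:R * (2 * r%:R - 1) ^ (k%:Z - 1).

Definition CR (r k : nat) : R :=
  (2 * r%:R - 1) ^+ k + 1 + (r%:R - 1) * (1 + (-1) ^+ k).

Definition ceil_len (lambda : R) (l : nat) : nat :=
  `|Num.ceil (lambda * l%:R)|%N.

(* The exponent [l - c - 1] may be negative, e.g., when [l = c = 1]. *)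
Definition omega (lambda : R) (r l i : nat) : R :=
  let c := ceil_len lambda l in
  CR r l - 4 * (i%:R - 1) * l%:R * (r%:R - 1)
             * (2 * r%:R - 1) ^ (l%:Z - c%:Z - 1).

Definition alpha (lambda : R) (r l i k : nat) : R :=
  let c := ceil_len lambda l in
  let l2 := (l %% c)%N in
  if k == 1%N then FR r c - 2 * (i%:R - 1) * l%:R
  else FR r c - 2 * (i%:R - 1) * l%:R
         - 2 * ((k%:R - 2) * c%:R + l2%:R + 1).

Definition p_ge (lambda : R) (r l m : nat) : R :=
  let c := ceil_len lambda l in
  let l1 := (l %/ c)%N in
  let l2 := (l %% c)%N in
  if FR r c < (2 * m * l)%:R then 0
  else ((CR r l) ^+ m)^-1 *
    \prod_(1 <= i < m.+1)
      Num.min (omega lambda r l i)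
        (FR r l2 *
         \prod_(1 <= k < l1.+1)
           Num.min ((2 * r%:R - 1) ^+ c) (alpha lambda r l i k)).

Definition relators (r l m : nat)
    (W : m.-tuple (l.-tuple (letter 'I_r))) : seq (word 'I_r) :=
  [seq tval w | w <- W].

Definition presentations (r l m : nat) :
    {set m.-tuple (l.-tuple (letter 'I_r))} :=
  [set W | all (@cyclically_reduced 'I_r) (relators W)].

(* Presentations are drawn uniformly from the finite set [presentations]. *)
Definition p_Cprime (lambda : R) (r l m : nat) : R :=
  #|[set W in presentations r l m | `[< Cprime lambda (relators W) >]]|%:R
  / #|presentations r l m|%:R.

End Counting.

(* Main.v *)
Require Import Defs.
From mathcomp Require Import all_boot all_order all_algebra.
From mathcomp Require Import all_classical all_reals all_analysis.
From mathcomp Require Import zify ring lra.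
Import Order.TTheory GRing.Theory Num.Theory.
Local Open Scope ring_scope.

(** Since [CR r l <= 2 q ^ l] for [q = 2r - 1], the [i]-th factor of [p_ge]
    divided by [CR r l] is at most [1 - a (i - 1) <= exp (- a (i - 1))], where
    [a = 2 l (r - 1) / q ^ (c + 1)] and [c] is the ceiling of [lambda * l].
    Multiplying, [p <= exp (- a m (m - 1) / 2)], and the bound follows on taking
    logarithms. Bounding the product factor by factor is legitimate because
    every factor is nonnegative: this is what [2 m l <= FR r c] guarantees. *)

Section Bounds.
Variables (R : realType) (r : nat).
Hypothesis r_ge2 : (2 <= r)%N.
Let q : R := 2 * r%:R - 1.

Lemma base_ge3 : 3 <= q.
Proof.
have : 2 <= r%:R :> R by rewrite ler_nat.
by rewrite /q; lra.
Qed.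

Let q_gt0 : 0 < q.
Proof. by have := base_ge3; lra. Qed.

Lemma FR_ge0 k : 0 <= FR R r k.
Proof. by rewrite mulr_ge0// exprz_ge0// ltW. Qed.

Lemma FR_base k : FR R r k = (q + 1) * q ^+ k / q.
Proof.
rewrite /FR -/q expfzDr ?gt_eqF// natrM -exprnP mulrA.
by have -> : 2%:R * r%:R = q + 1 by rewrite /q; ring.
Qed.

Lemma CR_ge k : q ^+ k <= CR R r k.
Proof.
rewrite /CR -/q -addrA lerDl addr_ge0// mulr_ge0//.
  by have := base_ge3; rewrite /q; lra.
by rewrite -signr_odd; case: odd; rewrite ?expr0 ?expr1; lra.
Qed.

(** The terms of [CR] beyond [q ^+ k] are at most [1 + 2 (r - 1) = q], which is at most [q ^+ k]
    once [k] is positive. *)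
Lemma CR_le k : (0 < k)%N -> CR R r k <= 2 * q ^+ k.
Proof.
move=> k_gt0; have q3 := base_ge3.
have qk : q <= q ^+ k by rewrite ler_eXnr//; lra.
have : q ^+ k + 1 + (r%:R - 1) * 2 <= 2 * q ^+ k by rewrite /q in qk *; lra.
apply: le_trans; rewrite /CR -/q lerD2l ler_wpM2l//.
  by rewrite /q in q3; lra.
by rewrite -signr_odd; case: odd; rewrite ?expr0 ?expr1; lra.
Qed.

Variables (lambda : R) (l : nat).
Hypothesis l_gt0 : (0 < l)%N.
Let c := ceil_len lambda l.

Lemma omegaE i : omega lambda r l i.+1 =
  CR R r l - 2 * i%:R * l%:R * (q - 1) * (q ^+ l / q ^+ c.+1).
Proof.
rewrite /omega -/c -/q.
have -> : l%:Z - c%:Z - 1 = l%:Z - c.+1%:Z by lia.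
rewrite expfzDr ?gt_eqF// -exprnN -exprnP; congr (_ - _).
by rewrite [in RHS]/q -(natr1 i); ring.
Qed.

(** By [CR_ge] it suffices that [2 i l (q - 1) <= q ^+ c.+1]. The hypothesis gives
    [2 i l q <= (q + 1) q ^+ c], and [(q - 1) (q + 1) <= q ^+ 2]. *)
Lemma omega_ge0 i : (2 * i * l)%:R <= FR R r c -> 0 <= omega lambda r l i.+1.
Proof.
move=> hi; have q3 := base_ge3.
rewrite omegaE subr_ge0 (le_trans _ (CR_ge l))//.
rewrite mulrCA ger_pMr ?exprn_gt0//.
rewrite ler_pdivrMr ?exprn_gt0// mul1r.
move: hi; rewrite FR_base ler_pdivlMr// !natrM => hi.
rewrite -(ler_pM2r q_gt0) exprSr.
have : 0 <= q ^+ c by rewrite exprn_ge0 ?ltW.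
nra.
Qed.

Lemma omega_le i : omega lambda r l i.+1 <=
  CR R r l * expR (- (2 * l%:R * (r%:R - 1) / q ^+ c.+1 * i%:R)).
Proof.
set a := _ / q ^+ c.+1; have q3 := base_ge3.
have CR0 : 0 < CR R r l by rewrite (lt_le_trans _ (CR_ge l))// exprn_gt0.
apply: (@le_trans _ _ (CR R r l * (1 - a * i%:R))); last first.
  by rewrite ler_pM2l// expR_ge1Dx.
rewrite omegaE [leRHS]mulrBr mulr1 lerD2l lerN2.
(* Since [q - 1 = 2 (r - 1)], the subtracted term is [4 i l (r - 1) q ^+ l / q ^+ c.+1]; one factor
   2 goes to [2 * q ^+ l], the bound on [CR], and the rest is [a * i]. *)
have -> : 2 * i%:R * l%:R * (q - 1) * (q ^+ l / q ^+ c.+1) =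
          2 * q ^+ l * (a * i%:R).
  by rewrite /a /q; ring.
rewrite ler_wpM2r ?CR_le// mulr_ge0// divr_ge0 ?exprn_ge0// ?(ltW q_gt0)//.
by rewrite mulr_ge0//; rewrite /q in q3; lra.
Qed.

(** Having [i.+1] in the hypothesis leaves a spare [2 l], which pays for the last term of [alpha]:
    for [2 <= k <= l %/ c], the sum [(k - 2) c + l %% c + 1] is at most [l]. *)
Lemma alpha_ge0 i k : (2 * i.+1 * l)%:R <= FR R r c -> (0 < k <= l %/ c)%N ->
  0 <= alpha lambda r l i.+1 k.
Proof.
move=> hi /andP[k0 kl]; rewrite /alpha -/c.
have {}hi : 2 * i%:R * l%:R + 2 * l%:R <= FR R r c.
  by apply: le_trans hi; rewrite !natrM -natr1; lra.
have -> : i.+1%:R - 1 = i%:R :> R by rewrite -natr1 addrK.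
case: eqP => [_|k1]; first by have := ler0n R l; lra.
(* If [c] were 0, then [l %/ c] would be 0 by convention, leaving no room for [k]. *)
have c_gt0 : (0 < c)%N by case: (c) kl => [|//]; rewrite divn0; lia.
have : ((k - 2) * c + l %% c + 1 <= l)%N.
  by have := divn_eq l c; nia.
rewrite -(ler_nat R) !natrD natrM natrB; last by lia.
lra.
Qed.

Lemma p_ge_le_expR m : (2 * m * l)%:R <= FR R r c ->
  p_ge lambda r l m <=
  expR (- (2 * l%:R * (r%:R - 1) / q ^+ c.+1 * \sum_(0 <= i < m) i%:R)).
Proof.
move=> hm; rewrite /p_ge -/c -/q ltNge hm /=.
have CR0 : 0 < CR R r l by rewrite (lt_le_trans _ (CR_ge l))// exprn_gt0.
rewrite mulrC ler_pdivrMr ?exprn_gt0// big_add1 /=.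
rewrite mulr_sumr -sumrN expR_sum mulrC.
rewrite -[X in CR _ _ _ ^+ X]subn0 -prodr_const_nat -big_split /=.
rewrite !big_mkord ler_prod// => -[i im] _ /=.
have hi : (2 * i.+1 * l)%:R <= FR R r c.
  by apply: le_trans hm; rewrite ler_nat leq_mul2r leq_mul2l im !orbT.
rewrite le_min omega_ge0 /=; last first.
  by apply: le_trans hi; rewrite ler_nat leq_mul2r leq_mul2l leqnSn !orbT.
(* The minimum is bounded above through [omega]; its other argument remains to be shown
   nonnegative. *)
rewrite ge_min omega_le andbT mulr_ge0 ?FR_ge0//.
rewrite big_nat_cond prodr_ge0// => k; rewrite andbT => kl.
by rewrite le_min exprn_ge0 ?(ltW q_gt0)// alpha_ge0.
Qed.

End Bounds.

(** The sum is [m (m - 1) / 2]; weakening it to a square lets the final square root isolate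
    [m - 1]. *)
Lemma sum_nat_ge_sqr (R : realType) (m : nat) :
  (0 < m)%N -> (m%:R - 1) ^+ 2 / 2 <= \sum_(0 <= i < m) i%:R :> R.
Proof.
case: m => // m _; elim: m => [|m IH]; first by rewrite big_nat1; lra.
rewrite big_nat_recr//= -(natr1 m.+1).
have := ler0n R m; move: IH; rewrite -!(natr1 m); nra.
Qed.

Theorem proposition4p3 (R : realType) (lambda : R) (r l m : nat) (p : R)
    (hlambda0 : 0 < lambda) (hlambda : lambda <= 1 / 6)
    (hr : (2 <= r)%N) (hl : (1 <= l)%N) (hm : (1 <= m)%N) (hp : 0 < p) :
  let bound : R :=
    1 + 2 * Num.sqrt (ln (1 / p) * (2 * r%:R - 1) ^+ (1 + ceil_len lambda l)
                      / (2 * l%:R * (r%:R - 1))) in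
  (p <= p_ge lambda r l m -> m%:R <= bound) /\
  (p <= p_Cprime lambda r l m -> p_Cprime lambda r l m <= p_ge lambda r l m ->
   m%:R <= bound).
Proof.
move=> bound.
suff H : p <= p_ge lambda r l m -> m%:R <= bound.
  by split=> // h1 h2; apply/H/(le_trans h1).
move=> hpge; rewrite /bound.
case: (leP (2 * m * l)%:R (FR R r (ceil_len lambda l))) => [hFR|hFR]; last first.
  by move: hpge; rewrite /p_ge hFR leNgt hp.
have {hpge} := le_trans hpge (@p_ge_le_expR R r hr lambda l hl m hFR).
set d := 2 * l%:R * _; set Q := _ ^+ _; set S := \sum_(_ <= _ < _) _ => hpS.
have q3 := @base_ge3 R r hr.
have d0 : 0 < d.
  by rewrite mulr_gt0// ?mulr_gt0 ?ltr0n//; lra.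
have Q0 : 0 < Q by rewrite exprn_gt0//; lra.
have lnS : d / Q * S <= ln (1 / p).
  by rewrite div1r lnV ?posrE// lerNr -(expRK (- _)) ler_ln ?posrE ?expR_gt0.
have SL : S <= ln (1 / p) * Q / d.
  by rewrite ler_pdivlMr// -ler_pdivrMr//; move: lnS; congr (_ <= _); ring.
have m1 : 0 <= m%:R - 1 :> R by rewrite subr_ge0 ler1n.
have m2 : (m%:R - 1) / 2 = Num.sqrt (((m%:R - 1) / 2) ^+ 2) :> R.
  by rewrite sqrtr_sqr ger0_norm// divr_ge0.
have : (m%:R - 1) / 2 <= Num.sqrt (ln (1 / p) * Q / d).
  rewrite m2 ler_wsqrtr// (le_trans _ SL)//.
  (* The square on the left is [(m - 1) ^+ 2 / 4], below the available [(m - 1) ^+ 2 / 2]; halving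
     [m - 1] matches the factor 2 before the root in [bound]. *)
  apply: le_trans (@sum_nat_ge_sqr R m hm); have := sqr_ge0 (m%:R - 1 : R); lra.
lra.
Qed.
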